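(* Let $T$ be a tournament on $n$ vertices whose skew-adjacency matrix $S$ is a skew-conference matrix, that is, $S^2=(1-n)I_n$. Then $u^{+}(T)\geq n/2$.
   Context: The skew-adjacency matrix of a tournament with vertex set $\{v_1,\ldots,v_n\}$ is the $n\times n$ zero-diagonal matrix $S=[s_{ij}]$ in which $s_{ij}=1$ and $s_{ji}=-1$ if $v_i$ dominates $v_j$. A tournament is unimodular if the determinant of its skew-adjacency matrix is $1$. For a tournament $T$ on $n$ vertices, $u^{+}(T)$ is the smallest number of vertices that must be added to $T$ to obtain a unimodular tournament, i.e. the smallest $k\ge 0$ such that some unimodular tournament on $n+k$ vertices contains $T$ as a subtournament. $I_n$ denotes the $n\times n$ identity matrix.
   Formalization: The case n = 2 is excluded, since there the claim is false: the tournament on two vertices has S^2 = -I = (1-2)I and det S = 1, so u^+(T) = 0 < 1 = n/2. *)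

(* Defs.v *)
From HB Require Import structures.
From mathcomp Require Import all_boot all_order all_algebra.

Set Implicit Arguments.
Unset Strict Implicit.
Unset Printing Implicit Defensive.

Import Order.TTheory GRing.Theory Num.Theory.
Local Open Scope ring_scope.

Definition is_tournament (n : nat) (A : {set 'I_n * 'I_n}) : bool :=
  [forall i, (i, i) \notin A] &&
  [forall i, forall j, (i != j) ==> (((i, j) \in A) (+) ((j, i) \in A))].

(* Arcs form a finite set, so that tournaments of a given order are a finType
   and the existence of a unimodular extension is a boolean. *)
Record tournament (n : nat) := Tournament {
  arcs :> {set 'I_n * 'I_n};
  arcsP : is_tournament arcs
}.

HB.instance Definition _ (n : nat) := [isSub for @arcs n].
HB.instance Definition _ (n : nat) := [Finite of tournament n by <:].

Definition dominates (n : nat) (T : tournament n) : rel 'I_n :=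
  fun i j => (i, j) \in arcs T.

Definition skew_adj (n : nat) (T : tournament n) : 'M[int]_n :=
  \matrix_(i, j) if dominates T i j then 1
                 else if dominates T j i then -1 else 0.

Definition unimodular (n : nat) (T : tournament n) : bool :=
  \det (skew_adj T) == 1.

(* Containment up to isomorphism, i.e. up to relabelling the vertices. *)
Definition subtournament (n m : nat) (T : tournament n) (U : tournament m)
    : bool :=
  [exists f : {ffun 'I_n -> 'I_m}, injectiveb f &&
    [forall i, forall j, dominates U (f i) (f j) == dominates T i j]].

Definition unimodular_ext (n : nat) (T : tournament n) (k : nat) : bool :=
  [exists U : tournament (n + k), unimodular U && subtournament T U].

Lemma dominates_irr (n : nat) (T : tournament n) i : dominates T i i = false.
Proof. by have /andP[/forallP/(_ i)/negbTE] := arcsP T. Qed.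

Lemma dominates_asym (n : nat) (T : tournament n) i j :
  i != j -> dominates T i j = ~~ dominates T j i.
Proof.
move=> ij; have /andP[_ /forallP/(_ i)/forallP/(_ j)] := arcsP T.
by rewrite ij /dominates; case: (_ \in _); case: (_ \in _).
Qed.

(* Doubling: every vertex v gets a twin v', with v dominating v'.  The
   skew-adjacency matrix of the double is [S, S + I; S - I, S], of determinant
   1, so that a unimodular extension always exists. *)
Definition double_arcs (n : nat) (T : tournament n)
    : {set 'I_(n + n) * 'I_(n + n)} :=
  [set p | match split p.1, split p.2 with
           | inl i, inr j => (i == j) || dominates T i j
           | inl i, inl j | inr i, inl j | inr i, inr j => dominates T i j
           end].

Lemma double_arcsP (n : nat) (T : tournament n) :
  is_tournament (double_arcs T).
Proof.
apply/andP; split.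
  by apply/forallP => i; rewrite inE /=; case: (split i) => k;
    rewrite dominates_irr.
apply/forallP => x; apply/forallP => y; apply/implyP; rewrite !inE /=.
rewrite -[X in X != y](splitK x) -[X in _ != X](splitK y).
case: (split x) => i; case: (split y) => j /=.
- rewrite (inj_eq (@lshift_inj _ _)) => /(dominates_asym T) ->.
  by case: (dominates T j i).
- move=> _; case: eqVneq => [->|/(dominates_asym T) ->] /=.
    by rewrite dominates_irr.
  by case: (dominates T j i).
- move=> _; case: eqVneq => [->|/(dominates_asym T) ->] /=.
    by rewrite dominates_irr.
  by case: (dominates T i j).
- rewrite (inj_eq (@rshift_inj _ _)) => /(dominates_asym T) ->.
  by case: (dominates T j i).
Qed.

Definition double (n : nat) (T : tournament n) : tournament (n + n) :=
  Tournament (double_arcsP T).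

Lemma double_dominates (n : nat) (T : tournament n) (x y : 'I_n + 'I_n) :
  dominates (double T) (unsplit x) (unsplit y) =
  match x, y with
  | inl i, inr j => (i == j) || dominates T i j
  | inl i, inl j | inr i, inl j | inr i, inr j => dominates T i j
  end.
Proof. by rewrite {1}/dominates inE /= !unsplitK. Qed.

Lemma skew_adj_double (n : nat) (T : tournament n) :
  let S := skew_adj T in
  skew_adj (double T) = block_mx S (S + 1%:M) (S - 1%:M) S.
Proof.
apply/matrixP => x y; rewrite -(splitK x) -(splitK y) mxE !double_dominates.
case: (split x) => i; case: (split y) => j /=.
- by rewrite block_mxEul mxE.
- rewrite block_mxEur !mxE.
  by case: eqVneq => [->|_] /=; rewrite ?dominates_irr ?addr0 ?add0r.
- rewrite block_mxEdl !mxE (eq_sym j).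
  by case: eqVneq => [->|_] /=; rewrite ?dominates_irr ?subr0 ?sub0r.
- by rewrite block_mxEdr mxE.
Qed.

Lemma unimodular_double (n : nat) (T : tournament n) : unimodular (double T).
Proof.
rewrite /unimodular skew_adj_double /=; set S := skew_adj T.
have -> : block_mx S (S + 1%:M) (S - 1%:M) S =
    block_mx 1%:M 1%:M 0 1%:M *m block_mx 1%:M 0 (S - 1%:M) 1%:M
      *m block_mx 1%:M 1%:M 0 1%:M :> 'M[int]_(n + n).
  rewrite !mulmx_block ?(mul0mx, mulmx0, mul1mx, mulmx1, add0r, addr0).
  by rewrite (addrC 1%:M) !subrK.
by rewrite !det_mulmx !det_ublock det_lblock !det1 !mulr1.
Qed.

Lemma unimodular_ext_exists (n : nat) (T : tournament n) :
  exists k, unimodular_ext T k.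
Proof.
exists n; apply/existsP; exists (double T); rewrite unimodular_double /=.
apply/existsP; exists [ffun i => lshift n i]; apply/andP; split.
  by apply/injectiveP => i j; rewrite !ffunE; apply: lshift_inj.
apply/forallP => i; apply/forallP => j; rewrite !ffunE.
by rewrite (double_dominates T (inl i) (inl j)).
Qed.

Definition u_plus (n : nat) (T : tournament n) : nat :=
  ex_minn (unimodular_ext_exists T).

(* Main.v *)
Require Import Defs.
From mathcomp Require Import all_boot all_order all_algebra.
From mathcomp Require Import zify.

Import Order.TTheory GRing.Theory Num.Theory.
Local Open Scope ring_scope.

(** If n is not 0 or 2, some prime p divides n - 1.  Modulo p the matrix S
    squares to zero, so its rank is at most n / 2.  On the other hand S is a
    principal submatrix of order n of a matrix of order n + k that is
    invertible modulo p, so deleting k rows and k columns leaves rank at least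
    n - k.  Hence n - k <= n / 2. *)

Lemma mxrank_rowsub1 (F : fieldType) (n m : nat) (f : 'I_n -> 'I_m) :
  injective f -> \rank (rowsub f (1%:M : 'M[F]_m)) = n.
Proof.
move=> f_inj; apply/eqP; rewrite -/(row_free _).
apply/row_freeP; exists (colsub f 1%:M).
by rewrite mulmx_colsub mulmx1; apply/matrixP=> i j; rewrite !mxE inj_eq.
Qed.

(** Selecting rows and columns is multiplying [A] by 0-1 matrices of ranks [n1] and [n2];
    Sylvester's rank inequality then applies, as the invertible [A] preserves rank. *)
Lemma mxrank_mxsub_unit (F : fieldType) (n1 n2 m : nat) (A : 'M[F]_m)
    (f : 'I_n1 -> 'I_m) (g : 'I_n2 -> 'I_m) :
    injective f -> injective g -> A \in unitmx ->
  (n1 + n2 - m <= \rank (mxsub f g A))%N.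
Proof.
move=> f_inj g_inj uA.
have -> : mxsub f g A = rowsub f 1%:M *m A *m (rowsub g 1%:M)^T.
  rewrite mul_rowsub_mx mul1mx trmx_mxsub trmx1 mulmx_colsub mulmx1.
  by apply/matrixP=> i j; rewrite !mxE.
apply: leq_trans (mxrank_mul_min _ _).
by rewrite mxrankMfree ?row_free_unit // mxrank_tr !mxrank_rowsub1.
Qed.

Lemma skew_adj_subtournament (n m : nat) (T : tournament n) (U : tournament m) :
    subtournament T U ->
  exists2 f : 'I_n -> 'I_m, injective f
    & skew_adj T = mxsub f f (skew_adj U).
Proof.
case/existsP=> f /andP[/injectiveP f_inj fP]; exists f => //.
have {}fP i j : dominates U (f i) (f j) = dominates T i j.
  by move/forallP/(_ i)/forallP/(_ j)/eqP: fP.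
by apply/matrixP=> i j; rewrite !mxE !fP.
Qed.

Lemma unimodular_ext_half (n k : nat) (T : tournament n) :
    n <> 2%N -> skew_adj T *m skew_adj T = (1 - n%:R) *: 1%:M ->
  unimodular_ext T k -> (n <= k.*2)%N.
Proof.
(* From here the order is [n.+1], so [p] must divide [n]. *)
case: n T => [//|n] T n2 hS /existsP[U /andP[/eqP detU]].
case/skew_adj_subtournament=> f f_inj defT.
have [p p_pr p_dvd] : exists2 p, prime p & (p %| n)%N.
  have [n_le1|n_gt1] := leqP n 1.
    (* Any prime divides 0, and [n2] excludes [n = 1]. *)
    by exists 2%N; case: n n2 n_le1 {T hS U detU f f_inj defT} => [|[]].
  by exists (pdiv n); rewrite ?pdiv_prime ?pdiv_dvd.
pose S := map_mx (intr : int -> 'F_p) (skew_adj T).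
have SS0 : S *m S = 0.
  rewrite -map_mxM hS mulrS opprD addrA subrr add0r.
  apply/matrixP=> i j; rewrite !mxE rmorphM rmorphN /= rmorph_nat.
  have /eqP-> : n%:R == 0 :> 'F_p by rewrite -(dvdn_pcharf (pchar_Fp p_pr)).
  by rewrite oppr0 mul0r.
have rankS : (n.+1 + n.+1 - (n.+1 + k) <= \rank S)%N.
  rewrite /S defT map_mxsub; apply: mxrank_mxsub_unit => //.
  (* Determinant 1 over the integers stays 1 modulo every prime. *)
  by rewrite unitmxE det_map_mx detU rmorph1 unitr1.
(* [SS0] bounds twice the rank of [S] by [n.+1]. *)
have := mulmx0_rank_max SS0; lia.
Qed.

Theorem mainTheorem5 (n : nat) (T : tournament n) (hn : n <> 2%N)
    (hS : skew_adj T *m skew_adj T = (1 - n%:R) *: 1%:M) :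
  n%:R / 2 <= (u_plus T)%:R :> rat.
Proof.
rewrite /u_plus; case: ex_minnP => k /(unimodular_ext_half _ _ _ hn hS) le_n_2k _.
by rewrite ler_pdivrMr // -natrM ler_nat muln2.
Qed.
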